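(* Let $\Omega=\mathbb{T}^3$ or $\Omega=\mathbb{R}^3$, and let $\{T_{\ell mn}\}_{\ell\ge 0,\,-\ell\le m\le \ell,\,n\ge 1}$ be the orthonormal divergence-free radiant beam basis, $T_{\ell mn}(\boldsymbol{x})=\nabla\times\left(f_{\ell n}(|\boldsymbol{x}|)Y_\ell^m(\hat{\boldsymbol{x}})\hat{\boldsymbol{x}}\right)$. For a divergence-free vector field $\boldsymbol{u}$ on $\Omega$ with coefficients $$a_{\ell mn}=\langle \boldsymbol{u},T_{\ell mn}\rangle_{L^2}=\int_\Omega \boldsymbol{u}(\boldsymbol{x})\cdot\overline{T_{\ell mn}(\boldsymbol{x})}\,d\boldsymbol{x},$$ the $L^2$ norm of $\boldsymbol{u}$ is conserved in the coefficient space: $$\|\boldsymbol{u}\|_{L^2}^2=\sum_{\ell=0}^\infty\sum_{m=-\ell}^{\ell}\sum_{n=1}^\infty |a_{\ell mn}|^2 .$$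
   Context: $H^s_{\mathrm{div}}(\Omega)=\{\boldsymbol{u}\in H^s(\Omega)^3:\nabla\cdot\boldsymbol{u}=0 \text{ in } \mathcal{D}'(\Omega)\}$. Divergence-free fields are taken in $H^s_{\mathrm{div}}(\Omega)$ with sufficient regularity for the coefficients to be defined (the paper says ''typically $s\ge 3$''). $Y_\ell^m$ is the complex spherical harmonic of degree $\ell$ and order $m$ on $S^2$, and $\hat{\boldsymbol{x}}=\boldsymbol{x}/|\boldsymbol{x}|$. The radial profile functions $f_{\ell n}:\mathbb{R}_+\to\mathbb{R}$ ($\ell\ge0$, $n\ge1$) are $C^\infty$ on $\mathbb{R}_+$, with appropriate decay at infinity (for $\Omega=\mathbb{R}^3$) or periodicity conditions (for $\Omega=\mathbb{T}^3$; in this case $f_{\ell n}(r)=j_\ell(\alpha_{\ell n}r)$ with $j_\ell$ the spherical Bessel function of the first kind and $\alpha_{\ell n}$ eigenvalues determined by boundary conditions), and satisfy $\int_0^\infty f_{\ell n}(r)f_{\ell n'}(r)\,r^2\,dr=\delta_{nn'}$. The coefficients $a_{\ell mn}$ are the forward Divergence-Free Radiant Transform of $\boldsymbol{u}$, and the inverse transform reconstructs $\boldsymbol{u}$ as $\boldsymbol{u}(\boldsymbol{x})=\sum_{\ell=0}^\infty\sum_{m=-\ell}^{\ell}\sum_{n=1}^\infty a_{\ell mn}T_{\ell mn}(\boldsymbol{x})$. Orthonormal basis refers to the $L^2(\Omega)$ inner product: $\int_\Omega T_{\ell mn}\cdot\overline{T_{\ell' m'n'}}\,d\boldsymbol{x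}=\delta_{\ell\ell'}\delta_{mm'}\delta_{nn'}$.
   Formalization: Orthonormality is required only for ℓ≥1, since T_{00n}=0. As the beams do not span all divergence-free fields, completeness is assumed only for u: its expansion converges to u in L². On T³ the Bessel form of the profiles, incompatible with their normalization, is dropped. *)

(* Defs.v *)
From HB Require Import structures.
From mathcomp Require Import all_boot all_order all_algebra.
From mathcomp Require Import all_classical all_reals all_analysis.
From mathcomp Require Import complex.

Set Implicit Arguments.
Unset Strict Implicit.
Unset Printing Implicit Defensive.

Import Order.TTheory GRing.Theory Num.Theory.
Import numFieldNormedType.Exports.

Local Open Scope classical_set_scope.
Local Open Scope complex_scope.
Local Open Scope ring_scope.

Section Space.
Variable R : realType.

(* Nested pairs rather than 'rV[R]_3: pairs carry both the normed-module
   structure (for 'D_v) and the product sigma-algebra (for Lebesgue measure).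
   The library norm of R * R * R is the sup norm, hence enorm below. *)

Definition coord3 (i : 'I_3) (x : R * R * R) : R :=
  match val i with 0%N => x.1.1 | 1%N => x.1.2 | _ => x.2 end.

Definition ebasis (i : 'I_3) : R * R * R :=
  ((i == 0 :> nat)%:R, (i == 1 :> nat)%:R, (i == 2 :> nat)%:R).

Definition enorm (x : R * R * R) : R :=
  Num.sqrt (\sum_(i < 3) coord3 i x ^+ 2).

(* x / |x|, with value 0 at the origin. *)
Definition xhat (x : R * R * R) : R * R * R := (enorm x)^-1 *: x.

(* R * R * R, with the Borel structure on which lebesgue_measure is defined. *)
Definition mpoint : Type :=
  (measurableTypeR R * measurableTypeR R * measurableTypeR R)%type.

HB.instance Definition _ := Measurable.on mpoint.

Definition leb3 : {measure set mpoint -> \bar R} :=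
  ((@lebesgue_measure R \x @lebesgue_measure R) \x @lebesgue_measure R)%E.

Definition sfield := (R * R * R)%type -> R[i].
Definition vfield := 'I_3 -> sfield.

Definition re_part (g : sfield) : R * R * R -> R := fun x => complex.Re (g x).
Definition im_part (g : sfield) : R * R * R -> R := fun x => complex.Im (g x).

(** The domain: R^3, or the torus (R / L Z)^3 of an arbitrary period L > 0. *)

Inductive domain := WholeSpace | Torus of R.

Definition valid_domain (Om : domain) : Prop :=
  match Om with WholeSpace => True | Torus L => 0 < L end.

(* A field on the torus is given by its values on the fundamental cell
   [-L/2, L/2)^3; the point of the torus represented by x in the cell lies at
   distance enorm x from the origin. Values outside the cell are irrelevant;
   periodicity enters through the test functions. *)
Definition carrier (Om : domain) : set (R * R * R) :=
  match Om with
  | WholeSpace => setT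
  | Torus L => [set x | forall i, - (L / 2) <= coord3 i x < L / 2]
  end.

Definition closed_cell (L : R) : set (R * R * R) :=
  [set x | forall i, - (L / 2) <= coord3 i x <= L / 2].

(** Integrals and L^2. *)

Definition cintegral (Om : domain) (g : sfield) : R[i] :=
  Rintegral leb3 (carrier Om) (re_part g) +i*
  Rintegral leb3 (carrier Om) (im_part g).

Definition vnorm2 (u : vfield) (x : R * R * R) : R :=
  \sum_(i < 3) Normc.normc (u i x) ^+ 2.

Definition L2norm2 (Om : domain) (u : vfield) : \bar R :=
  (\int[leb3]_(x in carrier Om) (vnorm2 u x)%:E)%E.

Definition in_L2 (Om : domain) (g : sfield) : Prop :=
  [/\ measurable_fun (carrier Om : set mpoint) (re_part g : mpoint -> R),
      measurable_fun (carrier Om : set mpoint) (im_part g : mpoint -> R) &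
      (\int[leb3]_(x in carrier Om) (Normc.normc (g x) ^+ 2)%:E < +oo)%E].

Definition inner (Om : domain) (u v : vfield) : R[i] :=
  cintegral Om (fun x => \sum_(i < 3) u i x * conjc (v i x)).

(** Distributional derivatives, H^s and H^s_div. *)

Definition partials (t : seq 'I_3) (phi : R * R * R -> R) : R * R * R -> R :=
  foldr (fun i g => fun x => 'D_(ebasis i) g x) phi t.

Definition smooth (phi : R * R * R -> R) : Prop :=
  forall t : seq 'I_3, continuous (partials t phi) /\
    forall i x, derivable (partials t phi) x (ebasis i).

Definition test_function (Om : domain) (phi : R * R * R -> R) : Prop :=
  smooth phi /\
  match Om with
  | WholeSpace => exists M : R, forall x, M < enorm x -> phi x = 0
  | Torus L => forall i x, phi (x + L *: ebasis i) = phi x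
  end.

Definition weak_derivative (Om : domain) (t : seq 'I_3) (v g : sfield) : Prop :=
  forall phi, test_function Om phi ->
    cintegral Om (fun x => v x * (partials t phi x)%:C) =
    (-1) ^+ size t * cintegral Om (fun x => g x * (phi x)%:C).

Definition in_Hs (Om : domain) (s : nat) (v : sfield) : Prop :=
  in_L2 Om v /\
  forall t : seq 'I_3, (size t <= s)%N ->
    exists2 g, in_L2 Om g & weak_derivative Om t v g.

Definition div_free (Om : domain) (u : vfield) : Prop :=
  forall phi, test_function Om phi ->
    \sum_(i < 3) cintegral Om (fun x => u i x * (partials [:: i] phi x)%:C) = 0.

Definition in_Hs_div (Om : domain) (s : nat) (u : vfield) : Prop :=
  (forall i, in_Hs Om s (u i)) /\ div_free Om u.

(** Spherical harmonics, as functions of a unit vector. *)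

(* Rodrigues' formula. *)
Definition legendre (l : nat) : {poly R} :=
  ((2 ^ l * l`!)%N%:R)^-1 *: (('X ^+ 2 - 1) ^+ l)^`(l).

(* With x = sin theta cos phi, y = sin theta sin phi, z = cos theta, the
   associated Legendre function (Condon-Shortley phase) times e^{i k phi} is
     (-1)^k (sin theta)^k P_l^(k)(cos theta) e^{i k phi}
       = (-1)^k P_l^(k)(z) (x + i y)^k. *)
Definition sph_nonneg (l k : nat) (w : R * R * R) : R[i] :=
  (Num.sqrt ((l.*2.+1)%:R / (4 * pi) * ((l - k)`!)%N%:R / ((l + k)`!)%N%:R) *
   (-1) ^+ k * ((legendre l)^`(k)).[coord3 2 w])%:C *
  (coord3 0 w +i* coord3 1 w) ^+ k.

(* Negz k stands for the order -(k+1). *)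
Definition sph_harm (l : nat) (m : int) (w : R * R * R) : R[i] :=
  match m with
  | Posz k => sph_nonneg l k w
  | Negz k => (-1) ^+ k.+1 * conjc (sph_nonneg l k.+1 w)
  end.

(** The beams T_{lmn} = curl (f_{ln}(|x|) Y_l^m(xhat) xhat). *)

Definition cpartial (i : 'I_3) (g : sfield) : sfield := fun x =>
  'D_(ebasis i) (re_part g) x +i* 'D_(ebasis i) (im_part g) x.

(* Addition in 'I_3 is modulo 3. *)
Definition curl (F : vfield) : vfield := fun i x =>
  cpartial (i + 1) (F (i + 2)) x - cpartial (i + 2) (F (i + 1)) x.

Definition beam (f : nat -> nat -> R -> R) (l : nat) (m : int) (n : nat) :
    vfield :=
  curl (fun i x =>
    (f l n (enorm x))%:C * sph_harm l m (xhat x) * (coord3 i (xhat x))%:C).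

(* The orders -l, ..., l are k - l for k : 'I_(2 l + 1). *)
Definition order_of (l : nat) (k : 'I_(l.*2.+1)) : int := k%:Z - l%:Z.

Definition beam_index (l : nat) (m : int) (n : nat) : Prop :=
  (`|m| <= l)%N /\ (1 <= n)%N.

(** Standing assumptions on the radial profiles. *)

Definition profile_smooth (f : nat -> nat -> R -> R) : Prop :=
  forall l n, (1 <= n)%N -> forall (k : nat) (r : R), 0 < r ->
    derivable ((f l n)^`(k)%classic) r 1.

Definition profile_normalized (f : nat -> nat -> R -> R) : Prop :=
  forall l n n', (1 <= n)%N -> (1 <= n')%N ->
    (\int[@lebesgue_measure R]_(r in `]0%R, +oo[)
        (f l n r * f l n' r * r ^+ 2)%:E)%E = ((n == n')%:R : R)%:E.

(* On the torus the beam, computed on the closed cell, takes the same value at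
   identified points of opposite faces. *)
Definition profile_boundary (Om : domain) (f : nat -> nat -> R -> R) : Prop :=
  match Om with
  | WholeSpace => forall l n, (1 <= n)%N -> f l n r @[r --> +oo] --> (0 : R)
  | Torus L => forall l m n, beam_index l m n ->
      forall i x, closed_cell L x -> coord3 i x = - (L / 2) ->
        forall j, beam f l m n j (x + L *: ebasis i) = beam f l m n j x
  end.

Definition radial_profiles (Om : domain) (f : nat -> nat -> R -> R) : Prop :=
  [/\ profile_smooth f, profile_normalized f & profile_boundary Om f].

(** Orthonormality, forward and inverse transform. *)

(* Unit norm is asked of degrees l >= 1 only: Y_0^0 is constant, so the beams
   of degree 0 are curls of radial fields and vanish identically. *)
Definition orthonormal_beams (Om : domain) (f : nat -> nat -> R -> R) : Prop :=
  (forall l m n, (1 <= l)%N -> beam_index l m n ->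
     forall i, in_L2 Om (beam f l m n i)) /\
  (forall l m n l' m' n', (1 <= l)%N -> (1 <= l')%N ->
     beam_index l m n -> beam_index l' m' n' ->
     inner Om (beam f l m n) (beam f l' m' n') =
       ((l == l') && (m == m') && (n == n'))%:R).

Definition coef (Om : domain) (f : nat -> nat -> R -> R) (u : vfield)
    (l : nat) (m : int) (n : nat) : R[i] :=
  inner Om u (beam f l m n).

Definition partial_sum (Om : domain) (f : nat -> nat -> R -> R) (u : vfield)
    (N : nat) : vfield := fun i x =>
  \sum_(0 <= l < N) \sum_(k < l.*2.+1) \sum_(1 <= n < N.+1)
    coef Om f u l (order_of k) n * beam f l (order_of k) n i x.

(* u = sum_{l,m,n} a_{lmn} T_{lmn}, with convergence in L^2. *)
Definition reconstructs (Om : domain) (f : nat -> nat -> R -> R)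
    (u : vfield) : Prop :=
  L2norm2 Om (fun i x => u i x - partial_sum Om f u N i x) @[N --> \oo]
    --> (0 : \bar R)%E.

End Space.

Arguments WholeSpace {R}.
Arguments Torus {R}.

(* Main.v *)
Require Import Defs.
From HB Require Import structures.
From mathcomp Require Import all_boot all_order all_algebra.
From mathcomp Require Import all_classical all_reals all_analysis.
From mathcomp Require Import complex.
From mathcomp Require Import measurable_realfun ring lra zify.

(** The identity is Parseval's formula for the orthonormal family of beams, and
    the L^2 convergence of the expansion plays the role of completeness.

    For a finite orthonormal family T_j and an L^2 field u, subtracting the
    projections <u, T_j> T_j one after the other removes exactly |<u, T_j>|^2
    from the squared norm each time ([sqr_norm_sub_proj]).  This gives the
    Bessel identity ([bessel_identity])
      || u - sum_j <u, T_j> T_j ||^2 = || u ||^2 - sum_j |<u, T_j>|^2.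
    Applied to the beams of degree l < N and radial index n <= N, its left side
    tends to 0 with N, hence the square partial sums of |a_{lmn}|^2 tend to
    || u ||^2.  As the terms are nonnegative, the limit of the square partial
    sums is the iterated series ([nneseries_square_cvg]).

    Degree 0 needs a separate treatment, since those beams have no unit norm.
    Y_0^0 is constant, so a beam of degree 0 is the curl of a radial field
    g(|x|) x: away from the origin, for j <> k, the derivative of its k-th
    component along e_j is g'(|x|) x_j x_k / |x|, which is symmetric in j and k,
    and the curl vanishes ([curl_radial]).  At the origin the derivatives need not exist, but a point
    has measure zero, so that all coefficients of degree 0 vanish ([coef00])
    and these terms drop out of both sides. *)

Import Order.TTheory GRing.Theory Num.Theory.
Import numFieldNormedType.Exports.

Set Implicit Arguments.
Unset Strict Implicit.

Local Open Scope classical_set_scope.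
Local Open Scope complex_scope.
Local Open Scope ring_scope.

(** * Square-integrable functions and complex integrals *)

Section RealSquareIntegrable.
Context d (T : measurableType d) (R : realType).
Variables (mu : {measure set T -> \bar R}) (D : set T) (mD : measurable D).
Implicit Types f g : T -> R.

(** Square integrability on [D] of a real function, with no quotient by a.e.
    equality. *)
Definition real_L2 f : Prop :=
  measurable_fun D f /\ mu.-integrable D (EFin \o (fun x => f x ^+ 2)).

Lemma integrable_bounded_by f g : measurable_fun D f ->
  (forall x, D x -> `|f x| <= g x) ->
  mu.-integrable D (EFin \o g) -> mu.-integrable D (EFin \o f).
Proof.
move=> mf fg; apply: le_integrable => //; first exact/measurable_EFinP.
move=> x Dx /=; rewrite lee_fin.
exact: le_trans (fg x Dx) (ler_norm _).
Qed.

(** A product of square-integrable functions is integrable, being dominated by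
    the sum of the squares. *)
Lemma real_L2_mul f g : real_L2 f -> real_L2 g ->
  mu.-integrable D (EFin \o (fun x => f x * g x)).
Proof.
move=> [mf f2] [mg g2].
apply: (@integrable_bounded_by _ (fun x => f x ^+ 2 + g x ^+ 2)).
- exact: measurable_funM.
- by move=> x _; rewrite ler_norml; nra.
- by apply: eq_integrable (integrableD mD f2 g2).
Qed.

Lemma real_L2D f g : real_L2 f -> real_L2 g -> real_L2 (fun x => f x + g x).
Proof.
move=> hf hg; have [mf f2] := hf; have [mg g2] := hg.
split; first exact: measurable_funD.
have fg := real_L2_mul hf hg.
apply: eq_integrable
  (integrableD mD (integrableD mD f2 g2) (integrableZl mD 2 fg)) => //.
move=> x _ /=; rewrite -EFinM -!EFinD; congr EFin; ring.
Qed.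

Lemma real_L2Z c f : real_L2 f -> real_L2 (fun x => c * f x).
Proof.
move=> [mf f2]; split; first exact: measurable_funM.
apply: eq_integrable (integrableZl mD (c ^+ 2) f2) => //.
by move=> x _ /=; rewrite -EFinM exprMn.
Qed.

Lemma real_L20 : real_L2 (fun=> 0).
Proof.
split; first exact: measurable_cst.
by apply: eq_integrable (integrable0 mu D) => // x _ /=; rewrite expr0n.
Qed.

End RealSquareIntegrable.

Section ComplexIntegral.
Context d (T : measurableType d) (R : realType).
Variables (mu : {measure set T -> \bar R}) (D : set T) (mD : measurable D).
Implicit Types g h : T -> R[i].

(** The integral of a complex function, taken on real and imaginary parts; a
    part whose extended-real integral is infinite contributes 0. *)
Definition complex_integral g : R[i] :=
  (\int[mu]_(x in D) complex.Re (g x)) +i* (\int[mu]_(x in D) complex.Im (g x)).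

(** Integrability of both real and imaginary parts. *)
Definition complex_integrable g : Prop :=
  mu.-integrable D (EFin \o (fun x => complex.Re (g x))) /\
  mu.-integrable D (EFin \o (fun x => complex.Im (g x))).

(** Square integrability of both real and imaginary parts. *)
Definition complex_L2 g : Prop :=
  real_L2 mu D (fun x => complex.Re (g x)) /\
  real_L2 mu D (fun x => complex.Im (g x)).

Lemma eq_complex_integral g h : (forall x, D x -> g x = h x) ->
  complex_integral g = complex_integral h.
Proof.
move=> gh; rewrite /complex_integral.
by congr (_ +i* _); apply: eq_Rintegral => x /set_mem Dx; rewrite gh.
Qed.

Lemma eq_complex_integrable g h : g =1 h ->
  complex_integrable g -> complex_integrable h.
Proof. by move=> /funext ->. Qed.

Lemma complex_integrable0 : complex_integrable (fun=> 0).
Proof. by split; exact: integrable0. Qed.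

Lemma complex_integral0 : complex_integral (fun=> 0) = 0.
Proof. by rewrite /complex_integral !Rintegral_cst// !mul0r. Qed.

Lemma complex_integrableD g h : complex_integrable g -> complex_integrable h ->
  complex_integrable (fun x => g x + h x).
Proof.
move=> [gr gi] [hr hi]; split.
- apply: eq_integrable (integrableD mD gr hr) => // x _ /=.
  by case: (g x) (h x) => [? ?] [].
- apply: eq_integrable (integrableD mD gi hi) => // x _ /=.
  by case: (g x) (h x) => [? ?] [].
Qed.

Lemma complex_integralD g h : complex_integrable g -> complex_integrable h ->
  complex_integral (fun x => g x + h x) =
  complex_integral g + complex_integral h.
Proof.
move=> [gr gi] [hr hi]; rewrite /complex_integral [RHS]/GRing.add /=.
congr (_ +i* _); rewrite -RintegralD//; apply: eq_Rintegral => x _.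
- by case: (g x) (h x) => [? ?] [].
- by case: (g x) (h x) => [? ?] [].
Qed.

Lemma complex_integrableZ c g : complex_integrable g ->
  complex_integrable (fun x => c * g x).
Proof.
case: c => a b [gr gi]; split.
- apply: eq_integrable
    (integrableD mD (integrableZl mD a gr) (integrableZl mD (- b) gi)) => //.
  by move=> x _ /=; rewrite -!EFinM -EFinD; case: (g x) => p q /=; rewrite mulNr.
- apply: eq_integrable
    (integrableD mD (integrableZl mD a gi) (integrableZl mD b gr)) => //.
  by move=> x _ /=; rewrite -!EFinM -EFinD; case: (g x).
Qed.

Lemma complex_integralZ c g : complex_integrable g ->
  complex_integral (fun x => c * g x) = c * complex_integral g.
Proof.
case: c => a b [gr gi]; rewrite /complex_integral [RHS]/GRing.mul /=.
have Z k (f : T -> R) : mu.-integrable D (EFin \o f) ->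
    mu.-integrable D (EFin \o (fun x => k * f x)).
  by move=> hf; apply: eq_integrable (integrableZl mD k hf).
congr (_ +i* _).
- rewrite -!RintegralZl// -RintegralB; [|by []|exact: Z|exact: Z].
  by apply: eq_Rintegral => x _; case: (g x).
- rewrite -!RintegralZl// -RintegralD; [|by []|exact: Z|exact: Z].
  by apply: eq_Rintegral => x _; case: (g x).
Qed.

Lemma complex_integral_conj g : complex_integrable g ->
  complex_integral (fun x => conjc (g x)) = conjc (complex_integral g).
Proof.
move=> [gr gi]; rewrite /complex_integral /=; congr (_ +i* _).
- by apply: eq_Rintegral => x _; case: (g x).
- rewrite -mulN1r -RintegralZl//; apply: eq_Rintegral => x _.
  by case: (g x) => p q /=; rewrite mulN1r.
Qed.

Lemma complex_integrable_sum I (r : seq I) (F : I -> T -> R[i]) :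
  (forall i, complex_integrable (F i)) ->
  complex_integrable (fun x => \sum_(i <- r) F i x).
Proof.
move=> hF; elim: r => [|i r IHr].
  by apply: eq_complex_integrable complex_integrable0 => x; rewrite big_nil.
apply: eq_complex_integrable (complex_integrableD (hF i) IHr) => x.
by rewrite big_cons.
Qed.

Lemma complex_L2_mul g h : complex_L2 g -> complex_L2 h ->
  complex_integrable (fun x => g x * conjc (h x)).
Proof.
move=> [gr gi] [hr hi]; split.
- apply: eq_integrable (integrableD mD (real_L2_mul mD gr hr)
    (real_L2_mul mD gi hi)) => // x _ /=.
  by case: (g x) (h x) => [? ?] [? ?] /=; rewrite mulrN opprK.
- have := integrableD mD (real_L2_mul mD gi hr)
    (integrableZl mD (-1) (real_L2_mul mD gr hi)).
  apply: eq_integrable => // x _ /=; rewrite -EFinM -EFinD.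
  by case: (g x) (h x) => [? ?] [? ?] /=; congr EFin; ring.
Qed.

Lemma complex_L2D g h : complex_L2 g -> complex_L2 h ->
  complex_L2 (fun x => g x + h x).
Proof.
move=> [gr gi] [hr hi].
have -> : (fun x => g x + h x) = (fun x =>
    (complex.Re (g x) + complex.Re (h x)) +i*
    (complex.Im (g x) + complex.Im (h x))).
  by apply/funext => x; case: (g x) (h x) => [? ?] [].
by split; exact: real_L2D.
Qed.

Lemma complex_L2Z c g : complex_L2 g -> complex_L2 (fun x => c * g x).
Proof.
case: c => a b [gr gi].
have -> : (fun x => (a +i* b) * g x) = (fun x =>
    (a * complex.Re (g x) + (- b) * complex.Im (g x)) +i*
    (a * complex.Im (g x) + b * complex.Re (g x))).
  by apply/funext => x; case: (g x) => p q; rewrite [LHS]/GRing.mul /= mulNr.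
by split; apply: real_L2D => //; exact: real_L2Z.
Qed.

Lemma complex_L20 : complex_L2 (fun=> 0).
Proof. by split; exact: real_L20. Qed.

End ComplexIntegral.

(** * The inner product of square-integrable vector fields *)

Section FieldsOnDomain.
Variables (R : realType) (Om : domain R).
Implicit Types u v w : vfield R.

Lemma measurable_carrier : measurable (carrier Om : set (mpoint R)).
Proof.
case: Om => [|L]; first exact: measurableT.
rewrite (_ : carrier _ = (`[- (L / 2), (L / 2)[%classic `*`
  `[- (L / 2), (L / 2)[%classic) `*` `[- (L / 2), (L / 2)[%classic).
  by apply: measurableX; first apply: measurableX; exact: measurable_itv.
apply/seteqP; split => [[[a b] c] /= h|[[a b] c] /=].
  rewrite !in_itv /=; split; first split.
  - exact: h ord0.
  - exact: h (@Ordinal 3 1 isT).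
  - exact: h (@Ordinal 3 2 isT).
rewrite !in_itv /= => -[[ha hb] hc] [[|[|[|//]]] i3].
- exact: ha.
- exact: hb.
- exact: hc.
Qed.

Lemma sqr_normcE (z : R[i]) :
  Normc.normc z ^+ 2 = complex.Re z ^+ 2 + complex.Im z ^+ 2.
Proof. by case: z => a b /=; rewrite sqr_sqrtr// addr_ge0// sqr_ge0. Qed.

(** Membership in L^2 through the modulus agrees with square integrability of
    both parts. *)
Lemma in_L2P (g : sfield R) :
  in_L2 Om g <-> complex_L2 (@leb3 R) (carrier Om : set (mpoint R)) g.
Proof.
have mOm := measurable_carrier.
split=> [[mr mi gfin]|[[mr ir] [mi ii]]].
  have mn : measurable_fun (carrier Om : set (mpoint R))
      (fun x => Normc.normc (g x) ^+ 2).
    under eq_fun do rewrite sqr_normcE.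
    by apply: measurable_funD; apply: measurable_funX.
  have gint : (@leb3 R).-integrable (carrier Om : set (mpoint R))
      (EFin \o (fun x => Normc.normc (g x) ^+ 2)).
    apply/integrableP; split; first exact/measurable_EFinP.
    under eq_integral do rewrite /= ger0_norm ?sqr_ge0//.
    exact: gfin.
  split; split => //; apply: (integrable_bounded_by _ _ _ gint) => //.
  - exact: measurable_funX.
  - by move=> x _; rewrite sqr_normcE ger0_norm ?sqr_ge0// lerDl sqr_ge0.
  - exact: measurable_funX.
  - by move=> x _; rewrite sqr_normcE ger0_norm ?sqr_ge0// lerDr sqr_ge0.
split=> //.
have /(integrable_lty mOm) := integrableD mOm ir ii.
congr (_ < _)%E; apply: eq_integral => x _ /=.
by rewrite -EFinD sqr_normcE.
Qed.

(** Vector fields with components in L^2 of the domain. *)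
Definition vector_L2 u : Prop := forall i, in_L2 Om (u i).

Lemma vector_L2D u v : vector_L2 u -> vector_L2 v ->
  vector_L2 (fun i x => u i x + v i x).
Proof.
move=> hu hv i; apply/in_L2P; apply: complex_L2D; first exact: measurable_carrier.
- exact/in_L2P/hu.
- exact/in_L2P/hv.
Qed.

Lemma vector_L2Z c u : vector_L2 u -> vector_L2 (fun i x => c * u i x).
Proof.
move=> hu i; apply/in_L2P; apply: complex_L2Z; first exact: measurable_carrier.
exact/in_L2P/hu.
Qed.

Lemma vector_L2_sum (I : eqType) (r : seq I) (c : I -> R[i]) (T : I -> vfield R) :
  {in r, forall j, vector_L2 (T j)} ->
  vector_L2 (fun i x => \sum_(j <- r) c j * T j i x).
Proof.
elim: r => [|j r IHr] hT.
  move=> i; under eq_fun do rewrite big_nil.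
  by apply/in_L2P; apply: complex_L20; exact: measurable_carrier.
under eq_fun do under eq_fun do rewrite big_cons.
apply: vector_L2D; first by apply: vector_L2Z; apply: hT; rewrite mem_head.
by apply: IHr => k kr; apply: hT; rewrite inE kr orbT.
Qed.

Lemma inner_integrable u v : vector_L2 u -> vector_L2 v ->
  complex_integrable (@leb3 R) (carrier Om : set (mpoint R))
    (fun x => \sum_(i < 3) u i x * conjc (v i x)).
Proof.
move=> hu hv.
apply: (@complex_integrable_sum _ _ _ _ _ measurable_carrier _ _
  (fun i x => u i x * conjc (v i x))) => i.
apply: complex_L2_mul; first exact: measurable_carrier.
- exact/in_L2P/hu.
- exact/in_L2P/hv.
Qed.

Lemma innerDl u v w : vector_L2 u -> vector_L2 v -> vector_L2 w ->
  inner Om (fun i x => u i x + v i x) w = inner Om u w + inner Om v w.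
Proof.
move=> hu hv hw.
transitivity (complex_integral (@leb3 R) (carrier Om : set (mpoint R)) (fun x =>
    \sum_(i < 3) u i x * conjc (w i x) + \sum_(i < 3) v i x * conjc (w i x))).
  apply: eq_complex_integral => x _; rewrite -big_split /=.
  by apply: eq_bigr => i _; rewrite mulrDl.
by rewrite (complex_integralD measurable_carrier)//; exact: inner_integrable.
Qed.

Lemma innerZl c u w : vector_L2 u -> vector_L2 w ->
  inner Om (fun i x => c * u i x) w = c * inner Om u w.
Proof.
move=> hu hw.
transitivity (complex_integral (@leb3 R) (carrier Om : set (mpoint R)) (fun x =>
    c * \sum_(i < 3) u i x * conjc (w i x))).
  apply: eq_complex_integral => x _; rewrite big_distrr /=.
  by apply: eq_bigr => i _; rewrite mulrA.
by rewrite (complex_integralZ measurable_carrier)//; exact: inner_integrable.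
Qed.

Lemma inner_conj u w : vector_L2 u -> vector_L2 w ->
  inner Om w u = conjc (inner Om u w).
Proof.
move=> hu hw.
transitivity (complex_integral (@leb3 R) (carrier Om : set (mpoint R)) (fun x =>
    conjc (\sum_(i < 3) u i x * conjc (w i x)))).
  apply: eq_complex_integral => x _; rewrite rmorph_sum /=.
  by apply: eq_bigr => i _; rewrite rmorphM /= conjcK mulrC.
by rewrite (complex_integral_conj measurable_carrier)//; exact: inner_integrable.
Qed.

Lemma innerDr u v w : vector_L2 u -> vector_L2 v -> vector_L2 w ->
  inner Om w (fun i x => u i x + v i x) = inner Om w u + inner Om w v.
Proof.
move=> hu hv hw; rewrite inner_conj//; last exact: vector_L2D.
rewrite innerDl// (inner_conj hu hw) (inner_conj hv hw).
exact: (rmorphD (@conjc R)).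
Qed.

Lemma innerZr c u w : vector_L2 u -> vector_L2 w ->
  inner Om w (fun i x => c * u i x) = conjc c * inner Om w u.
Proof.
move=> hu hw; rewrite inner_conj//; last exact: vector_L2Z.
rewrite innerZl// (inner_conj hu hw).
exact: (rmorphM (@conjc R)).
Qed.

Lemma inner_suml (I : eqType) (r : seq I) (c : I -> R[i]) (T : I -> vfield R) w :
  {in r, forall j, vector_L2 (T j)} -> vector_L2 w ->
  inner Om (fun i x => \sum_(j <- r) c j * T j i x) w =
  \sum_(j <- r) c j * inner Om (T j) w.
Proof.
move=> + hw; elim: r => [|j r IHr] hT.
  rewrite big_nil -[RHS](complex_integral0 (@leb3 R) measurable_carrier).
  apply: eq_complex_integral => x _.
  by rewrite big1// => i _; rewrite big_nil mul0r.
under eq_fun do under eq_fun do rewrite big_cons.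
have hj : vector_L2 (T j) by apply: hT; rewrite mem_head.
have hr : {in r, forall k, vector_L2 (T k)}.
  by move=> k kr; apply: hT; rewrite inE kr orbT.
rewrite innerDl//; [|exact: vector_L2Z|exact: vector_L2_sum].
by rewrite innerZl// IHr// big_cons.
Qed.

Lemma L2norm2E u : vector_L2 u ->
  L2norm2 Om u = (complex.Re (inner Om u u))%:E.
Proof.
move=> hu; have [hr _] := inner_integrable hu hu.
rewrite /inner /cintegral /= /Rintegral fineK.
  apply: eq_integral => x _; rewrite /vnorm2 /re_part.
  congr EFin; rewrite raddf_sum /=; apply: eq_bigr => i _.
  by rewrite sqr_normcE; case: (u i x) => a b /=; rewrite mulrN opprK.
exact: (integrable_fin_num measurable_carrier hr).
Qed.

(** Pythagoras: removing the projection on a unit vector [T] lowers the squared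
    norm by the squared modulus of the coefficient. *)
Lemma sqr_norm_sub_proj u T : vector_L2 u -> vector_L2 T -> inner Om T T = 1 ->
  complex.Re (inner Om (fun i x => u i x - inner Om u T * T i x)
                       (fun i x => u i x - inner Om u T * T i x)) =
  complex.Re (inner Om u u) - Normc.normc (inner Om u T) ^+ 2.
Proof.
move=> hu hT T1.
have E : (fun i x => u i x - inner Om u T * T i x) =
    (fun i x => u i x + (- inner Om u T) * T i x).
  by apply/funext => i; apply/funext => x; rewrite mulNr.
have hcT : vector_L2 (fun i x => (- inner Om u T) * T i x) by exact: vector_L2Z.
rewrite E innerDl// ?innerDr// ?innerZl// ?innerZr//; last exact: vector_L2D.
rewrite T1 (inner_conj hu hT) sqr_normcE.
case: (inner Om u u) (inner Om u T) => [a b] [p q] /=; ring.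
Qed.

(** Proved by removing the projections one at a time: the coefficient of [u]
    along [T k] is unchanged when the projections on the other, orthogonal,
    members have been removed. *)
Lemma bessel_identity (I : eqType) (r : seq I) (T : I -> vfield R) u :
  vector_L2 u -> uniq r -> {in r, forall j, vector_L2 (T j)} ->
  {in r &, forall j k, inner Om (T j) (T k) = (j == k)%:R} ->
  L2norm2 Om (fun i x => u i x - \sum_(j <- r) inner Om u (T j) * T j i x) =
  (L2norm2 Om u - \sum_(j <- r) (Normc.normc (inner Om u (T j)) ^+ 2)%:E)%E.
Proof.
move=> hu.
have hsub s : {in s, forall j, vector_L2 (T j)} ->
    vector_L2 (fun i x => u i x - \sum_(j <- s) inner Om u (T j) * T j i x).
  move=> hs; rewrite [X in vector_L2 X](_ : _ = (fun i x => u i x +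
      (-1) * \sum_(j <- s) inner Om u (T j) * T j i x)).
    by apply: vector_L2D => //; apply: vector_L2Z; exact: vector_L2_sum.
  by apply/funext => i; apply/funext => x; rewrite mulN1r.
move=> ur hr ho; rewrite !L2norm2E//; last exact: hsub.
rewrite sumEFin -EFinB; congr EFin.
elim: r ur hr ho => [_ _ _|k r IHr /andP[kr ur] hr ho].
  rewrite big_nil subr0; congr (complex.Re (inner _ _ _));
    by apply/funext => i; apply/funext => x; rewrite big_nil subr0.
have hk : vector_L2 (T k) by apply: hr; rewrite mem_head.
have hr' : {in r, forall j, vector_L2 (T j)}.
  by move=> j jr; apply: hr; rewrite inE jr orbT.
set w := fun i x => u i x - \sum_(j <- r) inner Om u (T j) * T j i x in IHr.
have hw : vector_L2 w by exact: hsub.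
have wk : inner Om w (T k) = inner Om u (T k).
  rewrite /w [X in inner Om X _](_ : _ = (fun i x => u i x +
      \sum_(j <- r) (- inner Om u (T j)) * T j i x)); last first.
    apply/funext => i; apply/funext => x; rewrite -sumrN.
    by congr (_ + _); apply: eq_bigr => j _; rewrite mulNr.
  rewrite innerDl//; last exact: vector_L2_sum.
  rewrite inner_suml// big_seq big1 ?addr0// => j jr.
  rewrite ho ?mem_head ?inE ?jr ?orbT// (_ : (j == k) = false) ?mulr0//.
  by apply: contraNF kr => /eqP <-.
rewrite big_cons.
have -> : (fun i x => u i x - \sum_(j <- k :: r) inner Om u (T j) * T j i x) =
    (fun i x => w i x - inner Om w (T k) * T k i x).
  apply/funext => i; apply/funext => x.
  by rewrite wk /w big_cons opprD addrCA addrC.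
rewrite sqr_norm_sub_proj// ?wk; last by rewrite ho ?mem_head// eqxx.
rewrite IHr//; first by rewrite opprD addrCA addrC.
by move=> i j ir jr; apply: ho; rewrite inE ?ir ?jr orbT.
Qed.

End FieldsOnDomain.

(** * Beams of degree zero *)

Section DegreeZero.
Variable R : realType.
Implicit Types x y : R * R * R.

Lemma enorm_ge0 x : 0 <= enorm x.
Proof. exact: sqrtr_ge0. Qed.

Lemma sqr_enorm x : enorm x ^+ 2 = \sum_(i < 3) coord3 i x ^+ 2.
Proof. by rewrite /enorm sqr_sqrtr// sumr_ge0// => i _; exact: sqr_ge0. Qed.

Lemma enorm_gt0 x : x != 0 -> 0 < enorm x.
Proof.
move=> x0; rewrite lt_neqAle enorm_ge0 andbT eq_sym; apply: contra x0 => /eqP r0.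
have := sqr_enorm x; rewrite r0 expr0n /= !big_ord_recl big_ord0 addr0.
case: x {r0} => [[a b] c]; rewrite /coord3 /= => /eqP; rewrite eq_sym.
rewrite !paddr_eq0 ?sqr_ge0 ?addr_ge0 ?sqr_ge0// !sqrf_eq0.
by move=> /andP[/eqP -> /andP[/eqP -> /eqP ->]].
Qed.

Lemma coord3_line (k j : 'I_3) x h :
  coord3 k (h *: ebasis R j + x) = h * (k == j)%:R + coord3 k x.
Proof.
by case: k j x => [[|[|[|//]]] ?] [[|[|[|//]]] ?] [[a b] c].
Qed.

Lemma enorm_line (j : 'I_3) x h :
  enorm (h *: ebasis R j + x) =
  Num.sqrt (enorm x ^+ 2 + 2 * h * coord3 j x + h ^+ 2).
Proof.
rewrite sqr_enorm /enorm; congr Num.sqrt.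
under eq_bigr do rewrite coord3_line.
rewrite !big_ord_recl !big_ord0.
case: j x => [[|[|[|//]]] ?] [[a b] c]; rewrite /coord3 /=; ring.
Qed.

Lemma derive_along_line (F : R * R * R -> R) x v :
  'D_v F x = derive1 (fun h : R => F (h *: v + x)) 0.
Proof.
rewrite derive1E /derive scale0r add0r.
by under [in RHS]eq_fun => h do rewrite /= addr0 [h%:A]mulr1.
Qed.

(** For k <> j the factor x_k is constant along the direction e_j, and the
    derivative of |x| in this direction is x_j / |x|. *)
Lemma partial_radial (g : R -> R) (j k : 'I_3) x :
  x != 0 -> derivable g (enorm x) 1 -> k != j ->
  'D_(ebasis R j) (fun y => g (enorm y) * coord3 k y) x =
  derive1 g (enorm x) * (coord3 j x / enorm x) * coord3 k x.
Proof.
move=> x0 dg kj; have r0 := enorm_gt0 x0.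
rewrite derive_along_line.
under eq_fun do rewrite coord3_line (negbTE kj) mulr0 add0r enorm_line.
pose q h := enorm x ^+ 2 + 2 * h * coord3 j x + h ^+ 2.
have q0 : Num.sqrt (q 0) = enorm x.
  by rewrite /q mulr0 mul0r expr0n /= !addr0 sqrtr_sqr gtr0_norm.
have dq : is_derive (0 : R) (1 : R) q (2 * coord3 j x).
  apply: is_derive_eq; rewrite /GRing.scale /=; ring.
have ds : is_derive (0 : R) (1 : R) (Num.sqrt \o q) (coord3 j x / enorm x).
  have qpos : 0 < q 0 by rewrite -sqrtr_gt0 q0.
  apply: is_derive_eq (is_derive1_comp (is_derive1_sqrt qpos) dq) _.
  rewrite q0; field; exact: lt0r_neq0.
have dgs : is_derive (0 : R) (1 : R) (g \o (Num.sqrt \o q))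
    (derive1 g (enorm x) * (coord3 j x / enorm x)).
  apply: is_derive1_comp => //=; rewrite q0 derive1E.
  exact: derivableP.
rewrite (derive1Mr (f := g \o (Num.sqrt \o q))); last exact: ex_derive.
by rewrite derive1E derive_val.
Qed.

Lemma sph_harm00 : exists c : R, forall w, sph_harm 0 0 w = c%:C.
Proof.
eexists => w; rewrite /sph_harm /sph_nonneg /legendre /= !expr0 !mulr1.
by rewrite !hornerE; reflexivity.
Qed.

(** The radial field h(|y|) y is irrotational away from the origin. *)
Lemma curl_radial (h : R -> R) x : x != 0 -> derivable h (enorm x) 1 ->
  forall i, curl (fun k y => (h (enorm y) * coord3 k y)%:C) i x = 0.
Proof.
move=> x0 dh i; rewrite /curl /cpartial /re_part /im_part /=.
rewrite !derive_cst.
have i12 : i + 1 != i + 2 :> 'I_3 by case: i => [[|[|[|]]]].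
rewrite !partial_radial// 1?eq_sym//; apply/eqP; rewrite subr_eq0; apply/eqP.
by congr (_ +i* _); ring.
Qed.

Lemma beam0_eq0 (f : nat -> nat -> R -> R) n x : profile_smooth f -> (1 <= n)%N ->
  x != 0 -> forall i, beam f 0 0 n i x = 0.
Proof.
move=> fs n1 x0 i; have [c Yc] := sph_harm00.
rewrite -(@curl_radial (fun r => f 0%N n r * r^-1 * c) x x0 _ i).
  congr (curl _ i x); apply/funext => k; apply/funext => y.
  rewrite Yc -!rmorphM /=; congr (_ %:C); rewrite /xhat.
  have -> : coord3 k ((enorm y)^-1 *: y) = (enorm y)^-1 * coord3 k y.
    by case: k y => [[|[|[|//]]] ?] [[? ?] ?].
  ring.
have r0 := enorm_gt0 x0.
have df : derivable (f 0%N n) (enorm x) 1 by have := fs 0%N n n1 0%N _ r0.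
apply: derivableM; last exact: derivable_cst.
apply: derivableM => //; apply: derivableV; last exact: derivable_id.
exact: lt0r_neq0.
Qed.

Lemma origin_setX :
  [set 0] = ([set 0] `*` [set 0]) `*` [set 0] :> set (mpoint R).
Proof.
by apply/seteqP; split=> [[[a b] c] [-> -> ->]//|[[a b] c] /= [[-> ->] ->]].
Qed.

Lemma measurable_origin : measurable ([set 0] : set (mpoint R)).
Proof.
rewrite origin_setX.
by apply: measurableX => //; apply: measurableX.
Qed.

Lemma leb3_origin : leb3 R ([set 0] : set (mpoint R)) = 0%E.
Proof.
rewrite origin_setX.
rewrite /leb3 /= product_measure1E//; last first.
  by apply: measurableX.
by rewrite [X in (_ * X)%E]lebesgue_measure_set1 mule0.
Qed.

End DegreeZero.

Section DegreeZeroCoefficients.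
Variables (R : realType) (Om : domain R).

(** No measurability of [h] is needed: [h] agrees with a constant function on
    the only point where it may be nonzero. *)
Lemma Rintegral_off_origin (h : mpoint R -> R) :
  (forall x, x != 0 -> h x = 0) ->
  Rintegral (leb3 R) (carrier Om : set (mpoint R)) h = 0.
Proof.
move=> h0; have mOm := measurable_carrier Om.
have m0 := @measurable_origin R.
rewrite /Rintegral (_ : integral _ _ _ = 0%E)//.
transitivity (\int[leb3 R]_(x in (carrier Om : set (mpoint R)) `&` [set 0%R])
    (h 0)%:E)%E.
  rewrite integral_mkcondr; apply: eq_integral => x _; rewrite patchE.
  case: ifPn => [|/negP x0]; first by rewrite inE => ->.
  by rewrite h0//; apply/eqP => x00; apply: x0; rewrite inE.
apply: null_set_integral; [exact: measurableI|exact: measurable_cst|].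
apply/eqP; rewrite eq_le measure_ge0 andbT -(leb3_origin R).
by apply: le_measure; rewrite ?inE//; exact: measurableI.
Qed.

Lemma coef00 (f : nat -> nat -> R -> R) (u : vfield R) n :
  profile_smooth f -> (1 <= n)%N -> coef Om f u 0 0 n = 0.
Proof.
move=> fs n1; rewrite /coef /inner.
have z x : x != 0 -> \sum_(i < 3) u i x * conjc (beam f 0 0 n i x) = 0.
  by move=> x0; rewrite big1// => i _; rewrite beam0_eq0// conjc0 mulr0.
rewrite /cintegral !Rintegral_off_origin// => x x0.
- by rewrite /im_part z.
- by rewrite /re_part z.
Qed.

End DegreeZeroCoefficients.

(** * Square partial sums of a nonnegative triple series *)

Section TripleSeries.
Local Open Scope ereal_scope.
Variables (R : realType) (K : nat -> nat).
Variable t : forall l, 'I_(K l) -> nat -> \bar R.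

(** If the partial sums over l < N, 1 <= n <= N of a nonnegative family
    converge, their limit is the iterated series. *)
Lemma nneseries_square_cvg (S : \bar R) :
  (forall l k n, 0 <= @t l k n) ->
  (\sum_(0 <= l < N) \sum_(k < K l) \sum_(1 <= n < N.+1) t k n) @[N --> \oo]
    --> S ->
  S = \sum_(0 <= l <oo) \sum_(k < K l) \sum_(1 <= n <oo) t k n.
Proof.
move=> t0; set A := fun N => _; move=> AS.
have Andecr : {homo A : M N / (M <= N)%N >-> M <= N}.
  move=> M N MN; rewrite /A.
  apply: (@le_trans _ _ (\sum_(0 <= l < M) \sum_(k < K l)
      \sum_(1 <= n < N.+1) t k n)).
    apply: lee_sum => l _; apply: lee_sum => k _.
    rewrite [leRHS](big_cat_nat (n := M.+1))//= leeDl//.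
    by apply: sume_ge0 => *; exact: t0.
  rewrite [leRHS](big_cat_nat (n := M))//= leeDl// sume_ge0// => l _.
  by apply: sume_ge0 => k _; apply: sume_ge0 => *; exact: t0.
have AleS N : A N <= S.
  rewrite -(cvg_lim _ AS)//; apply: lime_ge; first exact: cvgP AS.
  by exists N => // M /= NM; exact: Andecr.
have F0 l : 0 <= \sum_(k < K l) \sum_(1 <= n <oo) t k n.
  by apply: sume_ge0 => k _; apply: nneseries_ge0 => *; exact: t0.
apply/eqP; rewrite eq_le; apply/andP; split.
  rewrite -(cvg_lim _ AS)//; apply: lime_le; first exact: cvgP AS.
  apply: nearW => N; apply: le_trans (nneseries_lim_ge N _); last by move=> *.
  apply: lee_sum => l _; apply: lee_sum => k _.
  by apply: nneseries_lim_ge => *; exact: t0.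
apply: lime_le; first by apply: is_cvg_nneseries => *; exact: F0.
(* The outer partial sum up to [M] is the limit in [P] of rectangular sums,
   each of which is below the square sum of size [maxn M P]. *)
apply: nearW => M.
under eq_bigr => l _ do rewrite -nneseries_sum//.
rewrite -nneseries_sum; last by move=> l n _; apply: sume_ge0 => *; exact: t0.
apply: lime_le.
  by apply: is_cvg_nneseries => n _ _; apply: sume_ge0 => l _; apply: sume_ge0.
apply: nearW => P; apply: le_trans (AleS (maxn M P)).
rewrite exchange_big /=; under eq_bigr => l _ do rewrite exchange_big /=.
rewrite /A.
apply: (@le_trans _ _ (\sum_(0 <= l < M) \sum_(k < K l)
    \sum_(1 <= n < (maxn M P).+1) t k n)).
  apply: lee_sum => l _; apply: lee_sum => k _.
  have [P1|P1] := leqP P 1.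
    by rewrite [leLHS]big_geq// sume_ge0.
  rewrite [leRHS](big_cat_nat (n := P))//=; first last.
  - exact: leq_trans (leq_maxr _ _) (leqnSn _).
  - exact: ltnW.
  by rewrite leeDl//; apply: sume_ge0 => *; exact: t0.
rewrite [leRHS](big_cat_nat (n := M))//= ?leq_maxl// leeDl// sume_ge0// => l _.
by apply: sume_ge0 => k _; apply: sume_ge0 => *; exact: t0.
Qed.

End TripleSeries.

(** * The beams as a finite orthonormal family *)

Section BeamIndices.

(** The triples (l, m, n) with 1 <= l < N, |m| <= l and 1 <= n <= N; degree 0
    is left out, its beams vanishing off the origin. *)
Definition beam_indices (N : nat) : seq (nat * int * nat) :=
  [seq (p, n) |
    p <- [seq (l, order_of k) |
           l <- index_iota 1 N, k <- index_enum 'I_(l.*2.+1)],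
    n <- index_iota 1 N.+1].

Lemma order_of_inj l : injective (@order_of l).
Proof. by move=> j k /addIr [] /val_inj. Qed.

Lemma uniq_beam_indices N : uniq (beam_indices N).
Proof.
apply: allpairs_uniq; last by move=> [p n] [q m] _ _ [-> ->].
  apply: allpairs_uniq_dep; first exact: iota_uniq.
    by move=> l _; exact: index_enum_uniq.
  move=> [l k] [l' k'] _ _ /= [ll']; move: k'; rewrite -ll' => k'.
  by move=> /order_of_inj ->.
exact: iota_uniq.
Qed.

Lemma beam_indicesP N l m n : (l, m, n) \in beam_indices N ->
  (1 <= l)%N /\ beam_index l m n.
Proof.
move=> /allpairsPdep[p [n' [/allpairsPdep[l' [k [l1 _ ->]]] n1 [-> -> ->]]]].
move: l1 n1; rewrite !mem_index_iota => /andP[l1 _] /andP[n1 _]; split=> //.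
split=> //; rewrite /order_of; have := ltn_ord k.
move: (nat_of_ord k) => j; lia.
Qed.

(** A square partial sum whose terms of degree 0 vanish is a sum over
    [beam_indices]. *)
Lemma big_beam_indices (V : nmodType) (F : nat -> int -> nat -> V) N :
  (forall n, (1 <= n)%N -> F 0%N 0 n = 0) ->
  \sum_(0 <= l < N) \sum_(k < l.*2.+1) \sum_(1 <= n < N.+1) F l (order_of k) n =
  \sum_(p <- beam_indices N) F p.1.1 p.1.2 p.2.
Proof.
move=> F0; rewrite /beam_indices !big_allpairs_dep /=.
case: N => [|N]; first by rewrite !big_geq.
rewrite big_ltn// [X in X + _]big1 ?add0r// => k _.
rewrite big_nat big1// => n /andP[n1 _].
by rewrite (_ : order_of k = 0) ?F0// ord1.
Qed.

End BeamIndices.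

(** * Conservation of the L^2 norm *)

Unset Implicit Arguments.

Theorem theorem2p7 (R : realType) (Om : domain R) (f : nat -> nat -> R -> R)
    (hOm : valid_domain Om)
    (hf : radial_profiles Om f)
    (hT : orthonormal_beams Om f)
    (s : nat) (u : vfield R)
    (hu : in_Hs_div Om s u)
    (hrec : reconstructs Om f u) :
  L2norm2 Om u =
  (\sum_(0 <= l <oo) \sum_(k < l.*2.+1) \sum_(1 <= n <oo)
     (Normc.normc (coef Om f u l (order_of k) n) ^+ 2)%:E)%E.
Proof.
have [fs _ _] := hf; have [TL2 Tortho] := hT.
have uL2 : vector_L2 Om u by move=> i; have [[]] := hu.1 i.
apply: (nneseries_square_cvg (K := fun l => l.*2.+1)
  (t := fun l k n => (Normc.normc (coef Om f u l (order_of k) n) ^+ 2)%:E)).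
  by move=> l k n; rewrite lee_fin sqr_ge0.
pose T (p : nat * int * nat) := beam f p.1.1 p.1.2 p.2.
have bessel N : L2norm2 Om (fun i x => u i x - partial_sum Om f u N i x) =
    (L2norm2 Om u - \sum_(0 <= l < N) \sum_(k < l.*2.+1) \sum_(1 <= n < N.+1)
      (Normc.normc (coef Om f u l (order_of k) n) ^+ 2)%:E)%E.
  rewrite (big_beam_indices (F := fun l m n =>
    (Normc.normc (coef Om f u l m n) ^+ 2)%:E)); last first.
    by move=> n n1; rewrite coef00// Normc.normc0 expr0n.
  rewrite -(bessel_identity (T := T) uL2 (uniq_beam_indices N)).
  - congr L2norm2; apply/funext => i; apply/funext => x; congr (_ - _).
    rewrite /partial_sum (big_beam_indices (F := fun l m n =>
      coef Om f u l m n * beam f l m n i x))//.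
    by move=> n n1; rewrite coef00// mul0r.
  - by move=> [[l m] n] /beam_indicesP[l1 lmn] i; exact: TL2.
  - move=> [[l m] n] [[l' m'] n'] /beam_indicesP[l1 h] /beam_indicesP[l1' h'].
    by rewrite Tortho// !xpair_eqE.
(* The partial sums are || u ||^2 minus the squared norm of the remainder, and
   || u ||^2 is finite. *)
have ufin := L2norm2E uL2.
rewrite -[X in _ --> X]sube0.
apply: cvg_trans (cvgeB _ (cvg_cst _) hrec); last by rewrite fin_num_adde_defl.
apply: near_eq_cvg; apply: nearW => N /=; rewrite bessel ufin.
under eq_bigr do under eq_bigr do rewrite sumEFin.
under eq_bigr do rewrite sumEFin.
by rewrite sumEFin -!EFinB subKr.
Qed.
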